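(* There exists a (randomized) first-order method (called SGD-sparse) for continual finite-sum minimization with FO complexity $$O\left(\frac{G^{3}|\mathcal{D}|\log n}{\mu\,\epsilon^{2}}\right).$$ That is, given the accuracy target $\epsilon>0$ and any sequence of functions $f_1,\dots,f_n:\mathcal{D}\to\mathbb{R}$, each $\mu$-strongly convex, $L$-smooth and $G$-Lipschitz on the convex compact set $\mathcal{D}\subset\mathbb{R}^d$, the method outputs $\hat x_1,\dots,\hat x_n\in\mathcal{D}$ with $\mathbb{E}[g_i(\hat x_i)]-g_i(x_i^\star)\le\epsilon$ for every $i\in\{1,\dots,n\}$, while performing in total at most $O\left(\frac{G^{3}|\mathcal{D}|\log n}{\mu\,\epsilon^{2}}\right)$ first-order oracles.
   Context: Setting. $\mathcal{D}\subset\mathbb{R}^d$ is nonempty, convex and compact with diameter $|\mathcal{D}|=\max_{x,y\in\mathcal{D}}\|x-y\|$; $\|\cdot\|$ is the Euclidean norm. Each $f_i:\mathcal{D}\to\mathbb{R}$ is differentiable and, for all $x,y\in\mathcal{D}$: $f_i(x)\ge f_i(y)+\nabla f_i(y)^\top(x-y)+\frac{\mu}{2}\|x-y\|^2$ ($\mu$-strong convexity, $\mu>0$); $|f_i(x)-f_i(y)|\le G\|x-y\|$, with $\|\nabla f_i(x)\|\le G$ ($G$-Lipschitz); $\|\nabla f_i(x)-\nabla f_i(y)\|\le L\|x-y\|$ ($L$-smooth). Prefix functions: $g_i(x):=\frac1i\sum_{j=1}^i f_j(x)$ and $x_i^\star:=\arg\min_{x\in\mathcal{D}}g_i(x)$.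 Continual finite-sum minimization: given $f_1,\dots,f_n$ and $\epsilon>0$, output $\hat x_1,\dots,\hat x_n\in\mathcal{D}$ with $g_i(\hat x_i)\le g_i(x_i^\star)+\epsilon$ for each $i$ (if $\hat x_i$ is random: $\mathbb{E}[g_i(\hat x_i)]-g_i(x_i^\star)\le\epsilon$). First-order method: it starts from a point $\hat x_0\in\mathcal{D}$ and proceeds in stages $i=1,\dots,n$. At stage $i$ it runs $T_i$ rounds; at round $t$ it performs a finite set $Q_i^t$ of first-order oracles (FOs), each FO being a pair $q=(q_{\rm value},q_{\rm index})$ with $q_{\rm value}\in\mathcal{D}$, $q_{\rm index}\le i$, which returns the gradient $\nabla f_{q_{\rm index}}(q_{\rm value})$; it uses the information gathered so far (and possibly internal randomness) to determine its intermediate points $x_i^t\in\mathcal{D}$, its subsequent queries, and finally the output $\hat x_i\in\mathcal{D}$ of stage $i$. The method may use the known quantities $\mathcal{D},\mu,L,G,\epsilon$. Its FO complexity is $\sum_{i=1}^n\sum_{t=1}^{T_i}|Q_i^t|$. The $O(\cdot)$ hides an absolute constant; it is understood for $n\ge2$ and all sufficiently small $\epsilon>0$ (the threshold may depend on $\mu,L,G,|\mathcal{D}|$). *)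

(* Defs.v *)
From HB Require Import structures.
From mathcomp Require Import all_boot all_order all_algebra finmap.
From mathcomp Require Import all_classical all_reals all_analysis.

Set Implicit Arguments.
Unset Strict Implicit.
Unset Printing Implicit Defensive.

Import Order.TTheory GRing.Theory Num.Theory.
Import numFieldNormedType.Exports.

Local Open Scope classical_set_scope.
Local Open Scope ring_scope.

(* The norm [`|x|] that the library puts on ['rV[R]_d] is the sup norm, hence
   the explicit Euclidean norm. *)
Definition dotv (R : realType) (d : nat) (u v : 'rV[R]_d) : R :=
  \sum_(k < d) u 0 k * v 0 k.

Definition enorm (R : realType) (d : nat) (u : 'rV[R]_d) : R :=
  Num.sqrt (dotv u u).

Definition diam (R : realType) (d : nat) (D : set 'rV[R]_d) : R :=
  sup [set enorm (x - y) | x in D & y in D].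

(* A set [D] is used as the type of its elements, with the topology induced by
   R^d.  The functions live on [D] only, which may have empty interior, so the
   derivative is taken along [D].  When [D] is not full-dimensional it does not
   determine the gradient; the gradient map [df] is therefore part of the data,
   and all conditions below bear on the pair [(f, df)]. *)
Definition is_gradient (R : realType) (d : nat) (D : set 'rV[R]_d)
    (f : D -> R) (df : D -> 'rV[R]_d) : Prop :=
  forall y : D,
    (f x - f y - dotv (df y) (\val x - \val y)) / enorm (\val x - \val y)
      @[x --> y^'] --> (0 : R).

Definition strongly_convex (R : realType) (d : nat) (D : set 'rV[R]_d)
    (mu : R) (f : D -> R) (df : D -> 'rV[R]_d) : Prop :=
  forall x y : D,
    f x >= f y + dotv (df y) (\val x - \val y)
               + mu / 2 * enorm (\val x - \val y) ^+ 2.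

Definition G_lipschitz (R : realType) (d : nat) (D : set 'rV[R]_d)
    (G : R) (f : D -> R) (df : D -> 'rV[R]_d) : Prop :=
  (forall x y : D, `|f x - f y| <= G * enorm (\val x - \val y)) /\
  (forall x : D, enorm (df x) <= G).

Definition L_smooth (R : realType) (d : nat) (D : set 'rV[R]_d)
    (L : R) (df : D -> 'rV[R]_d) : Prop :=
  forall x y : D, enorm (df x - df y) <= L * enorm (\val x - \val y).

Definition admissible (R : realType) (d : nat) (D : set 'rV[R]_d)
    (mu L G : R) (f : D -> R) (df : D -> 'rV[R]_d) : Prop :=
  [/\ is_gradient f df, strongly_convex mu f df,
      G_lipschitz G f df & L_smooth L df].

(* The sequence [f] is indexed from 1. *)
Definition prefix_mean (R : realType) (d : nat) (D : set 'rV[R]_d)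
    (f : nat -> D -> R) (i : nat) (x : D) : R :=
  i%:R^-1 * \sum_(1 <= j < i.+1) f j x.

Definition is_argmin (R : realType) (d : nat) (D : set 'rV[R]_d)
    (g : D -> R) (xs : D) : Prop :=
  forall x : D, g xs <= g x.

(* A first-order oracle call (value, index). *)
Definition FO (R : realType) (d : nat) (D : set 'rV[R]_d) : choiceType :=
  (D * nat)%type.

(* A history is the chronological list of what the method has seen and done:
   [Round a x] is a round that received the answered calls [a] and then moved to
   the intermediate point [x]; [Output x] closes a stage.  Every history starts
   with [Output x0], where [x0] is the starting point. *)
Variant event (R : realType) (d : nat) (D : set 'rV[R]_d) : Type :=
  | Round of seq (FO D * 'rV[R]_d) & D
  | Output of D.

(* Everything a method decides is a function of its internal randomness
   [w : Omega], the stage [i], the round [t] (both counted from 1) and the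
   history; the objective functions are accessible only through the answers
   recorded in the history. *)
Structure fo_method (R : realType) (d : nat) (D : set 'rV[R]_d)
    (Omega : Type) : Type := FOMethod {
  fom_start : D;
  fom_rounds : Omega -> nat -> seq (event D) -> nat;
  fom_query : Omega -> nat -> nat -> seq (event D) -> {fset FO D};
  fom_query_index : forall w i t h q,
    q \in fom_query w i t h -> (1 <= q.2 <= i)%N;
  fom_point : Omega -> nat -> nat -> seq (event D) ->
    seq (FO D * 'rV[R]_d) -> D;
  fom_output : Omega -> nat -> seq (event D) -> D }.

Section Run.
Context (R : realType) (d : nat) (D : set 'rV[R]_d) (Omega : Type).
Variables (M : fo_method D Omega) (df : nat -> D -> 'rV[R]_d) (w : Omega).

Definition answers (Q : {fset FO D}) : seq (FO D * 'rV[R]_d) :=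
  [seq (q, df q.2 q.1) | q <- enum_fset Q].

(* The history after [t] rounds of stage [i], if the stage began with [h]. *)
Fixpoint after_rounds (i : nat) (h : seq (event D)) (t : nat) :
    seq (event D) :=
  if t is s.+1 then
    let h' := after_rounds i h s in
    let a := answers (fom_query M w i t h') in
    rcons h' (Round a (fom_point M w i t h' a))
  else h.

Fixpoint after_stage (i : nat) : seq (event D) :=
  if i is k.+1 then
    let h := after_stage k in
    let h' := after_rounds i h (fom_rounds M w i h) in
    rcons h' (Output (fom_output M w i h'))
  else [:: Output (fom_start M)].

(* Meaningful for stages [i >= 1] and rounds [t >= 1] only. *)
Definition run_rounds (i : nat) : nat := fom_rounds M w i (after_stage i.-1).

Definition run_query (i t : nat) : {fset FO D} :=
  fom_query M w i t (after_rounds i (after_stage i.-1) t.-1).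

Definition run_output (i : nat) : D :=
  fom_output M w i (after_rounds i (after_stage i.-1) (run_rounds i)).

Definition fo_complexity (n : nat) : nat :=
  \sum_(1 <= i < n.+1) \sum_(1 <= t < (run_rounds i).+1) #|` run_query i t|.

End Run.

(* Main.v *)
(* SGD is run afresh only at the sparse stages i where i - p > alpha * i, p being
   the previous such stage and alpha = eps / (2 G |D|).  Between two updates at
   most a fraction alpha of the prefix is new, which costs at most
   alpha G |D| = eps / 2 in accuracy, and since ln i grows by at least alpha at
   each update there are O(ln n / alpha) of them.  At an update, projected SGD
   with step sizes 2 / (mu (t + 1)) and the average of its iterates weighted by t
   reaches accuracy eps / 2 on the prefix mean in T = O(G^2 / (mu eps)) rounds
   of one oracle call each, from any starting point. *)
Require Import Defs.
From HB Require Import structures.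
From mathcomp Require Import all_boot all_order all_algebra finmap.
From mathcomp Require Import all_classical all_reals all_analysis.
From mathcomp Require Import ring lra.

Import Order.TTheory GRing.Theory Num.Theory.
Import numFieldNormedType.Exports.

Local Open Scope classical_set_scope.
Local Open Scope ring_scope.

(** * Euclidean geometry: inner product, diameter, projection *)

Section Euclid.
Context {R : realType} {d : nat}.
Implicit Types (u v x y : 'rV[R]_d) (D : set 'rV[R]_d).

Lemma dotvC u v : dotv u v = dotv v u.
Proof. by apply: eq_bigr => k _; rewrite mulrC. Qed.

Lemma dotvDl u v x : dotv (u + v) x = dotv u x + dotv v x.
Proof. by rewrite -big_split; apply: eq_bigr => k _; rewrite !mxE mulrDl. Qed.

Lemma dotvZl a u x : dotv (a *: u) x = a * dotv u x.
Proof. by rewrite mulr_sumr; apply: eq_bigr => k _; rewrite !mxE mulrA. Qed.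

Lemma dotvDr u v x : dotv x (u + v) = dotv x u + dotv x v.
Proof. by rewrite dotvC dotvDl !(dotvC _ x). Qed.

Lemma dotvZr a u x : dotv x (a *: u) = a * dotv x u.
Proof. by rewrite dotvC dotvZl dotvC. Qed.

Lemma dotvNl u x : dotv (- u) x = - dotv u x.
Proof. by rewrite -scaleN1r dotvZl mulN1r. Qed.

Lemma dotvNr u x : dotv x (- u) = - dotv x u.
Proof. by rewrite dotvC dotvNl dotvC. Qed.

Lemma dotvv_ge0 u : 0 <= dotv u u.
Proof. by apply: sumr_ge0 => k _; rewrite -expr2 sqr_ge0. Qed.

Lemma dotvv_le0 u : dotv u u <= 0 -> u = 0.
Proof.
move=> u0; have {u0}/eqP: dotv u u = 0 by apply/le_anti; rewrite u0 dotvv_ge0.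
rewrite psumr_eq0 => [/allP u0|k _]; last by rewrite -expr2 sqr_ge0.
apply/rowP => k; rewrite mxE; apply/eqP.
by have := u0 k (mem_index_enum _); rewrite -expr2 sqrf_eq0.
Qed.

Lemma enorm_ge0 u : 0 <= enorm u.
Proof. exact: sqrtr_ge0. Qed.

Lemma sqr_enorm u : enorm u ^+ 2 = dotv u u.
Proof. by rewrite sqr_sqrtr ?dotvv_ge0. Qed.

Lemma dotvDD u v : dotv (u + v) (u + v) = dotv u u + 2 * dotv u v + dotv v v.
Proof. by rewrite dotvDl !dotvDr (dotvC v u); ring. Qed.

Lemma dotvBB u v : dotv (u - v) (u - v) = dotv u u - 2 * dotv u v + dotv v v.
Proof. by rewrite dotvDD dotvNl !dotvNr; ring. Qed.

Lemma dotvv_continuous (z : 'rV[R]_d) :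
  continuous (fun x : 'rV[R]_d => dotv (x - z) (x - z)).
Proof.
apply: (@continuous_big _ _ _ _ _ (@add_continuous R^o) _ _
  (fun k (x : 'rV[R]_d) => (x - z) 0 k * (x - z) 0 k)) => k _ x.
have c : {for x, continuous (fun x : 'rV[R]_d => (x - z) 0 k)}.
  rewrite (_ : (fun x : 'rV[R]_d => (x - z) 0 k) = (fun x => x 0 k - z 0 k)).
    by apply: continuousB; [exact: coord_continuous|exact: cst_continuous].
  by apply/funext => y; rewrite !mxE.
exact: continuousM.
Qed.

(** A [sup] bounds only a set that is bounded above: compactness bounds all coordinates by some [M],
    hence all distances. *)
Lemma enorm_le_diam {D} : compact D -> {in D &, forall x y, enorm (x - y) <= diam D}.
Proof.
move=> /compact_bounded[M0 [_ /(_ (`|M0| + 1))]].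
have -> : M0 < `|M0| + 1 by rewrite ltr_pwDr ?ler_norm.
move=> /(_ isT); set M := _ + 1 => DM.
have M_ge0 : 0 <= M by rewrite addr_ge0.
have cb x : D x -> forall k, `|x 0 k| <= M.
  move=> Dx k; apply: le_trans (DM _ Dx).
  by rewrite [leRHS]/Num.norm /= mx_normrE; apply/bigmax_geP; right => /=; exists (0, k).
move=> x y; rewrite !inE => Dx Dy.
apply: sup_upper_bound; last by exists x => //; exists y.
split; first by exists (enorm (x - y)), x => //; exists y.
exists (Num.sqrt (\sum_(k < d) (2 * M) ^+ 2)) => _ [a Da [b Db <-]].
rewrite ler_wsqrtr//; apply: ler_sum => k _; rewrite -expr2 !mxE.
rewrite -ler_sqrt ?sqr_ge0// !sqrtr_sqr.
apply: (@le_trans _ _ (2 * M)); last exact: ler_norm.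
rewrite (le_trans (ler_normB _ _))// mulr2n mulrDl mul1r lerD//; exact: cb.
Qed.

Lemma convex_setP D : convex_set D -> forall (a b : D) (t : R), 0 <= t <= 1 ->
  (1 - t) *: \val a + t *: \val b \in D.
Proof.
move=> cD a b t /andP[t0 t1].
have t01 : Itv.spec (@Itv.num_sem R) (Itv.Real `[0%Z, 1%Z]) t.
  by rewrite /Itv.num_sem /= in_itv /= t0 t1 ger0_real.
have := cD (\val b) (\val a) (Itv.mk t01) (valP b) (valP a).
by rewrite [conv _ _ _]addrC.
Qed.

(** Compactness gives a point [p] nearest to [z]. In the expansion of [z - u = (p - u) - (p - z)]
    the cross term has the right sign, since the angle at [p] is at least right. *)
Lemma ex_proj D : D !=set0 -> convex_set D -> compact D ->
  forall z, exists p : D, forall u : D,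
  dotv (\val p - \val u) (\val p - \val u) <= dotv (z - \val u) (z - \val u).
Proof.
move=> D0 cD kD z.
have [|p pD pmin] := EVT_min_rV D0 kD (f := fun x : 'rV[R]_d => dotv (x - z) (x - z)).
  by apply: continuous_subspaceT; exact: dotvv_continuous.
exists (SigSub pD) => u /=.
(* Optimality of [p] along the segment from [p] to [v] gives [c >= 0]. *)
set v := \val u; set c := dotv (p - z) (v - p); set b := dotv (v - p) (v - p).
have b_ge0 : 0 <= b by exact: dotvv_ge0.
have key t : 0 <= t <= 1 -> 0 <= 2 * t * c + t ^+ 2 * b.
  move=> t01; have := pmin _ (convex_setP D cD (SigSub pD) u t t01).
  rewrite /= -/v.
  have -> : (1 - t) *: p + t *: v - z = (p - z) + t *: (v - p).
    by apply/rowP => k; rewrite !mxE; ring.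
  by rewrite [leRHS]dotvDD dotvZl !dotvZr -/c -/b; lra.
have c_ge0 : 0 <= c.
  rewrite leNgt; apply/negP => c0.
  have bc : 0 < b - c by lra.
  (* At this [t] the quadratic is [t ^+ 2 * (2 * c - b) < 0]. The denominator [b - c] instead of [b]
     keeps [t <= 1] and covers [b = 0]. *)
  have := key (- c / (b - c)); rewrite divr_ge0 ?oppr_ge0 ?(ltW c0) ?(ltW bc)//=.
  rewrite ler_pdivrMr// mul1r => /(_ ltac:(lra)).
  have -> : 2 * (- c / (b - c)) * c + (- c / (b - c)) ^+ 2 * b
          = (c / (b - c)) ^+ 2 * (2 * c - b).
    by field; rewrite gt_eqF.
  apply/negP; rewrite -ltNge pmulr_rlt0; first lra.
  by rewrite exprn_even_gt0//= mulf_neq0 ?invr_neq0 ?(gt_eqF bc)// lt_eqF.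
have -> : z - v = (p - v) - (p - z) by apply/rowP => k; rewrite !mxE; ring.
rewrite [leRHS]dotvBB.
have -> : dotv (p - v) (p - z) = - c by rewrite dotvC -[p - v]opprB dotvNr.
have := dotvv_ge0 (p - z); lra.
Qed.

End Euclid.

(** * Convex combinations in [D] *)

Section StronglyConvex.
Context {R : realType} {d : nat} {D : set 'rV[R]_d}.

(** The default [a] is never reached when [D] is convex and [t] lies in [0, 1]. *)
Definition mean (t : R) (a b : D) : D :=
  insubd a ((1 - t) *: \val a + t *: \val b).

Lemma val_mean t a b : convex_set D -> 0 <= t <= 1 ->
  \val (mean t a b) = (1 - t) *: \val a + t *: \val b.
Proof. by move=> cD t01; rewrite val_insubd convex_setP. Qed.

(** In the tangent bounds at the mean point, taken towards [a] and [b] with weights [1 - t] and [t],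
    the gradient terms cancel. *)
Lemma strongly_convex_mean mu f df t a b :
  convex_set D -> 0 <= mu -> @strongly_convex R d D mu f df -> 0 <= t <= 1 ->
  f (mean t a b) <= (1 - t) * f a + t * f b.
Proof.
move=> cD mu0 scf t01; set z := mean t a b.
have lin x : f z + dotv (df z) (\val x - \val z) <= f x.
  apply: le_trans (scf x z); rewrite lerDl.
  by rewrite mulr_ge0 ?sqr_ge0// divr_ge0.
have /andP[t0 t1] := t01.
have := lin a; have := lin b; rewrite val_mean//.
have -> : \val a - ((1 - t) *: \val a + t *: \val b) = t *: (\val a - \val b).
  by apply/rowP => k; rewrite !mxE; ring.
have -> : \val b - ((1 - t) *: \val a + t *: \val b)
        = (t - 1) *: (\val a - \val b).
  by apply/rowP => k; rewrite !mxE; ring.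
rewrite !dotvZr => /(ler_wpM2l t0) B; rewrite -subr_ge0 in t1.
move=> /(ler_wpM2l t1) A; lra.
Qed.

Lemma prefix_mean_mean mu (f : nat -> D -> R) df i t a b :
  convex_set D -> 0 <= mu ->
  (forall j, (1 <= j <= i)%N -> strongly_convex mu (f j) (df j)) ->
  0 <= t <= 1 ->
  prefix_mean f i (mean t a b)
    <= (1 - t) * prefix_mean f i a + t * prefix_mean f i b.
Proof.
move=> cD mu0 scf t01; rewrite /prefix_mean !(mulrCA _ i%:R^-1) -mulrDr.
apply: ler_wpM2l; first by rewrite invr_ge0.
rewrite !mulr_sumr -big_split/=; apply: ler_sum_nat => j ji.
by apply: (strongly_convex_mean mu _ (df j)) => //; exact: scf.
Qed.

End StronglyConvex.

(** * Projected SGD and its error averaged over all index sequences *)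

Section Sgd.
Context {R : realType} {d : nat} {D : set 'rV[R]_d}.
Variables (mu G : R) (proj : 'rV[R]_d -> D) (x0 : D).
Hypotheses (mu_gt0 : 0 < mu) (cD : convex_set D).
Hypothesis projP : forall z (u : D),
  dotv (\val (proj z) - \val u) (\val (proj z) - \val u)
    <= dotv (z - \val u) (z - \val u).

Definition sgd_next (t : nat) (x : D) (g : 'rV[R]_d) : D :=
  proj (\val x - (2 / (mu * t.+1%:R)) *: g).

(* Folding these steps gives weight t to the t-th iterate. *)
Definition sgd_avg (t : nat) (z x : D) : D := mean (2 / t.+1%:R) z x.

Variables (f : nat -> D -> R) (df : nat -> D -> 'rV[R]_d).

(* Next iterate and current average after [t] rounds; round [t] uses the
   function of index [(s t.-1).+1]. *)
Fixpoint sgd (s : nat -> nat) (t : nat) : D * D :=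
  if t is t'.+1 then
    let: (x, z) := sgd s t' in
    (sgd_next t x (df (s t').+1 x), sgd_avg t z x)
  else (x0, x0).

Lemma eq_sgd s s' t :
  (forall r, (r < t)%N -> s r = s' r) -> sgd s t = sgd s' t.
Proof.
elim: t => //= t IHt ss'; rewrite IHt ?ss'// => r rt; apply: ss'.
exact: ltnW.
Qed.

Variable i : nat.
Hypothesis scf : forall j, (1 <= j <= i)%N -> strongly_convex mu (f j) (df j).
Hypothesis lipf : forall j, (1 <= j <= i)%N -> G_lipschitz G (f j) (df j).

Let g := prefix_mean f i.

Variable u : D.

Let dist2 (x : D) : R := dotv (\val x - \val u) (\val x - \val u).

(** Projection and strong convexity put the factor [1 - mu * eta] on [dist2 x], with [eta] the step
    size. The weight [mu / 4 * t * (t + 1)] makes this telescope in [t], and the gradient term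
    becomes [t / (t + 1) * G ^+ 2 / mu]. *)
Lemma sgd_next_le t x j : (1 <= t)%N -> (1 <= j <= i)%N ->
  mu / 4 * (t%:R * t.+1%:R) * dist2 (sgd_next t x (df j x))
  <= mu / 4 * (t.-1%:R * t%:R) * dist2 x + G ^+ 2 / mu
     - t%:R * (f j x - f j u).
Proof.
case: t => // t _ ji; set T := t.+1; set eta := 2 / (mu * T.+1%:R).
have T0 : 0 < T.+1%:R :> R by rewrite ltr0n.
have t0 : 0 <= t%:R :> R by rewrite ler0n.
have eta_gt0 : 0 < eta by rewrite divr_gt0// mulr_gt0.
have [_ Gj] := lipf _ ji.
have g2 : dotv (df j x) (df j x) <= G ^+ 2.
  by rewrite -sqr_enorm ler_pXn2r// nnegrE ?enorm_ge0// (le_trans (enorm_ge0 _) (Gj x)).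
have := scf _ ji u x; rewrite sqr_enorm.
have dux : dotv (\val u - \val x) (\val u - \val x) = dist2 x.
  by rewrite -opprB dotvNl dotvNr opprK.
rewrite dux -opprB dotvNr => fu.
have := projP (\val x - eta *: df j x) u.
rewrite (addrAC (\val x)) [leRHS]dotvBB dotvZl !dotvZr.
rewrite (dotvC (_ - _) (df j x)) -/(sgd_next T x (df j x)) -!/(dist2 _).
set c := dotv _ _ in fu *; move=> le1.
have le2 : dist2 (sgd_next T x (df j x)) <=
    (1 - mu * eta) * dist2 x - 2 * eta * (f j x - f j u) + eta ^+ 2 * G ^+ 2.
  have : eta * (f j x - f j u + mu / 2 * dist2 x) <= eta * c.
    by rewrite ler_pM2l//; lra.
  have : eta * (eta * dotv (df j x) (df j x)) <= eta * (eta * G ^+ 2).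
    by rewrite !ler_pM2l.
  lra.
have w0 : 0 <= mu / 4 * (T%:R * T.+1%:R) by rewrite !mulr_ge0 ?ltW.
apply: le_trans (ler_wpM2l w0 le2) _.
have -> : mu / 4 * (T%:R * T.+1%:R) * ((1 - mu * eta) * dist2 x
    - 2 * eta * (f j x - f j u) + eta ^+ 2 * G ^+ 2)
  = mu / 4 * (t%:R * T%:R) * dist2 x - T%:R * (f j x - f j u)
    + T%:R / T.+1%:R * (G ^+ 2 / mu).
  rewrite /eta /T -(natr1 t.+1) -(natr1 t); field.
  by rewrite gt_eqF// !natr1 pnatr_eq0.
rewrite [leLHS]addrAC lerD2r lerD2l.
apply: ler_piMl; first by rewrite divr_ge0 ?sqr_ge0// ltW.
by rewrite ler_pdivrMr// mul1r ler_nat.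
Qed.

(** A Lyapunov function; [t * (t + 1) / 2] is the total of the averaging weights 1 to t. *)
Let potential t (s : D * D) : R :=
  t%:R * t.+1%:R / 2 * (g s.2 - g u) + mu / 4 * (t%:R * t.+1%:R) * dist2 s.1.

Hypothesis i_gt0 : (0 < i)%N.

(** A sum over [q < i] is [i] times the expectation over a uniform index. Convexity charges the new
    average [t.+1 * (g x - g u)]; the gains [f q.+1 x - f q.+1 u] average to [g x - g u], so the two
    cancel. *)
Lemma potential_step t x z :
  \sum_(q < i) potential t.+1 (sgd_next t.+1 x (df q.+1 x), sgd_avg t.+1 z x)
  <= i%:R * (potential t (x, z) + G ^+ 2 / mu).
Proof.
have i0 : i%:R != 0 :> R by rewrite pnatr_eq0 -lt0n.
have sumE : \sum_(q < i) (f q.+1 x - f q.+1 u) = i%:R * (g x - g u).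
  rewrite /g /prefix_mean -mulrBr mulrA divff// mul1r -sumrB.
  by rewrite (big_addn 0 _ 1) subn1 /= big_mkord; apply: eq_bigr => q _; rewrite addn1.
have T0 : 0 < t.+2%:R :> R by rewrite ltr0n.
have T1 : 0 < t.+1%:R :> R by rewrite ltr0n.
have avg_le : t.+1%:R * t.+2%:R / 2 * (g (sgd_avg t.+1 z x) - g u)
    <= t%:R * t.+1%:R / 2 * (g z - g u) + t.+1%:R * (g x - g u).
  have th01 : 0 <= (2 : R) / t.+2%:R <= 1.
    by rewrite divr_ge0//= ler_pdivrMr// mul1r ler_nat.
  have := prefix_mean_mean mu f df i _ z x cD (ltW mu_gt0) scf th01.
  rewrite -/g -/(sgd_avg t.+1 z x) => le1.
  have w0 : 0 <= t.+1%:R * t.+2%:R / 2 :> R by rewrite divr_ge0 ?mulr_ge0// ltW.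
  apply: le_trans (_ : _ <= t.+1%:R * t.+2%:R / 2 *
    ((1 - 2 / t.+2%:R) * g z + 2 / t.+2%:R * g x - g u)) _.
    by apply: ler_wpM2l => //; rewrite lerD2r.
  rewrite le_eqVlt; apply/predU1P; left; rewrite -(natr1 t.+1) -(natr1 t); field.
  by move: T0 T1; rewrite -(natr1 t.+1) -(natr1 t) => T0 T1; rewrite gt_eqF.
apply: le_trans (_ : _ <= \sum_(q < i) (potential t (x, z) + G ^+ 2 / mu
  + t.+1%:R * (g x - g u) - t.+1%:R * (f q.+1 x - f q.+1 u))) _.
  apply: ler_sum => q _; rewrite /potential /=.
  have := sgd_next_le t.+1 x q.+1 isT (ltn_ord q); rewrite [t.+1.-1]/=; lra.
rewrite sumrB -[X in _ - X]mulr_sumr sumE sumr_const card_ord -mulr_natl; lra.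
Qed.

(** Base-[i] digit of rank [r]. As [k] runs below [i ^ t], its first [t] digits run once through all
    index sequences, so an average over [k] is an expectation over [t] independent uniform draws. *)
Definition digit (k r : nat) : nat := (k %/ i ^ r %% i)%N.

Lemma sum_digits (F : nat -> R) m :
  \sum_(k < m * i) F k = \sum_(r < m) \sum_(q < i) F (q * m + r)%N.
Proof.
rewrite exchange_big/= -(big_mkord xpredT F) mulnC big_nat_mul big_mkord.
apply: eq_bigr => q _; rewrite -{1}[(q * m)%N]add0n big_addn mulSn addnK.
by rewrite big_mkord; apply: eq_bigr => r _; rewrite addnC.
Qed.

Lemma sum_potential_le t :
  \sum_(k < i ^ t) potential t (sgd (digit k) t)
  <= (i ^ t)%:R * (t%:R * (G ^+ 2 / mu)).
Proof.
elim: t => [|t IHt].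
  by rewrite expn0 big_ord1 /potential !(mul0r, mulr0, addr0).
rewrite expnSr (sum_digits (fun k => potential t.+1 (sgd (digit k) t.+1))) natrM.
apply: le_trans (_ : _ <= \sum_(r < i ^ t)
    i%:R * (potential t (sgd (digit r) t) + G ^+ 2 / mu)) _.
  apply: ler_sum => r _.
  (* Adding a multiple of [i ^ t] keeps the lower digits: the first [t] rounds depend on [r] only,
     and the top digit [q] is the next index drawn. *)
  have E (q : 'I_i) : sgd (digit (q * i ^ t + r)) t = sgd (digit r) t.
    apply: eq_sgd => e et; rewrite /digit.
    have -> : (q * i ^ t = q * i ^ (t - e.+1) * i * i ^ e)%N.
      by rewrite -!mulnA -expnS -expnD subnK.
    by rewrite divnMDl ?expn_gt0 ?i_gt0// modnMDl.
  case S: (sgd (digit r) t) => [x z].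
  apply: le_trans (potential_step t x z); apply: ler_sum => q _ /=.
  rewrite E S.
  have -> : digit (q * i ^ t + r) t = q => //.
  by rewrite /digit divnMDl ?expn_gt0 ?i_gt0// divn_small// addn0 modn_small.
rewrite -mulr_sumr big_split/= sumr_const card_ord -(mulr_natl (G ^+ 2 / mu)).
rewrite [_ * i%:R]mulrC -[leRHS]mulrA ler_wpM2l// -(natr1 t).
by rewrite mulrDl mul1r mulrDr lerD2r.
Qed.

Lemma sum_sgd_le t : (0 < t)%N ->
  \sum_(k < i ^ t) (g (sgd (digit k) t).2 - g u)
  <= (i ^ t)%:R * (2 * G ^+ 2 / (mu * t.+1%:R)).
Proof.
move=> t_gt0; have t0 : 0 < t%:R :> R by rewrite ltr0n.
have w0 : 0 < t%:R * t.+1%:R / 2 :> R by rewrite divr_gt0// mulr_gt0// ltr0n.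
rewrite -(ler_pM2l w0) mulr_sumr.
apply: le_trans (le_trans (sum_potential_le t) _).
  apply: ler_sum => k _; rewrite /potential lerDl.
  by rewrite mulr_ge0 ?dotvv_ge0// !mulr_ge0// ltW.
rewrite le_eqVlt; apply/predU1P; left; rewrite -(natr1 t); field.
by rewrite ?gt_eqF// ?natr1 ?pnatr_eq0 -?lt0n.
Qed.

End Sgd.

(** * A uniform integer drawn from the uniform law on [0, 1] *)

Section UniformIndex.
Context {R : realType}.

(** The sample space is all of [R]; 0 is a default on a set of probability zero. *)
Definition uniform_index (N : nat) (w : R) : nat :=
  if 0 <= w < 1 then Num.truncn (w * N%:R) else 0%N.

Let cell (N k : nat) : set R := `[k%:R / N%:R, k.+1%:R / N%:R[.

(** Splitting off the default [F 0] makes the formula hold for every [w]; integrability and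
    expectation then reduce to indicators of cells. *)
Let uniform_index_sum (F : nat -> R) N w : (0 < N)%N ->
  F (uniform_index N w)
  = F 0%N + \sum_(k < N) (F k - F 0%N) * \1_(cell N k) w.
Proof.
move=> N_gt0; have N0 : 0 < N%:R :> R by rewrite ltr0n.
have cellE (k : nat) : \1_(cell N k) w = (k%:R <= w * N%:R < k.+1%:R)%R%:R :> R.
  by rewrite indicE mem_setE in_itv/= ler_pdivrMr// ltr_pdivlMr.
rewrite /uniform_index; case: ifPn => [/andP[w0 w1]|w01]; last first.
  rewrite big1 ?addr0// => k _; rewrite cellE.
  case: andP => [[kw wk]|_]; last by rewrite mulr0.
  case/negP: w01; rewrite -(pmulr_lge0 _ N0) (le_trans _ kw)//=.
  by rewrite -(ltr_pM2r N0) mul1r (lt_le_trans wk)// ler_nat.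
have w0N : 0 <= w * N%:R by rewrite mulr_ge0.
have mN : (Num.truncn (w * N%:R) < N)%N.
  rewrite -(ltr_nat R) (le_lt_trans _ (_ : w * N%:R < _))// ?truncn_le//.
  by rewrite -ltr_pdivlMr// divff// gt_eqF.
rewrite (bigD1 (Ordinal mN))//= cellE truncn_itv// mulr1 big1 => [|k km]; first ring.
rewrite cellE -truncn_eq// eq_sym [_ == _](_ : _ = false) ?mulr0//.
by apply/negbTE; apply: contra km => /eqP e; apply/eqP/val_inj.
Qed.

Let P : probability _ R := uniform_prob (@ltr01 R).

Let P_cell N (k : 'I_N) : P (cell N k) = (N%:R^-1)%:E.
Proof.
have N0 : 0 < N%:R :> R by rewrite ltr0n (leq_ltn_trans _ (ltn_ord k)).
have mcell : measurable (cell N k) by exact: measurable_itv.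
rewrite /P /= /uniform_prob (eq_integral (cst 1%:E)) => [|x].
  rewrite integral_cst// mul1e /= /cell lebesgue_measure_itv/= lte_fin.
  rewrite ltr_pM2r ?invr_gt0// ltr_nat ltnSn.
  by rewrite -EFinB -mulrBl -natr1 addrAC subrr add0r mul1r.
rewrite mem_setE in_itv/= /uniform_pdf subr0 invr1 => /andP[kx xk].
rewrite (le_trans _ kx) ?divr_ge0//= (le_trans (ltW xk))//.
by rewrite ler_pdivrMr// mul1r ler_nat.
Qed.

Lemma uniform_indexP (F : nat -> R) N : (0 < N)%N ->
  P.-integrable setT (fun w => (F (uniform_index N w))%:E) /\
  'E_P[fun w => F (uniform_index N w)]%E = (N%:R^-1 * \sum_(k < N) F k)%:E.
Proof.
move=> N_gt0.
have N0 : 0 < N%:R :> R by rewrite ltr0n.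
pose h (k : 'I_N) (w : R) := ((F k - F 0%N)%:E * (\1_(cell N k) w)%:E)%E.
have FE : (fun w => (F (uniform_index N w))%:E)
    = (fun w => (F 0%N)%:E + \sum_(k < N) h k w)%E.
  apply/funext => w; rewrite uniform_index_sum// EFinD -sumEFin.
  by congr (_ + _)%E; apply: eq_bigr => k _; rewrite EFinM.
have mcell k : measurable (cell N k) by exact: measurable_itv.
have iindic k : P.-integrable setT (fun w => (\1_(cell N k) w)%:E).
  exact: (integrable_indic P (mcell k)).
have ih k : P.-integrable setT (h k).
  by apply: integrableZl => //; exact: iindic.
have is_ : P.-integrable setT (fun w => \sum_(k < N) h k w)%E.
  exact: integrable_sum.
have ic : P.-integrable setT (fun _ => (F 0%N)%:E).
  exact: finite_measure_integrable_cst.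
have cst_int : (\int[P]_x (F 0%N)%:E = (F 0%N)%:E)%E.
  rewrite integral_cst// -[RHS]mule1; congr (_ * _)%E; exact: probability_setT.
rewrite expectation.unlock FE; split; first exact: (integrableD measurableT ic is_).
rewrite integralD// cst_int integral_sum//.
have -> : (\sum_(k < N) \int[P]_x h k x = \sum_(k < N) ((F k - F 0%N) / N%:R)%:E)%E.
  apply: eq_bigr => k _; rewrite integralZl// EFinM; congr (_ * _)%E.
  by rewrite -(P_cell _ k) -[in RHS](setIT (cell N k));
    exact: (integral_indic P measurableT (mcell k)).
rewrite sumEFin -EFinD -mulr_suml sumrB sumr_const card_ord; congr (_%:E).
by rewrite -(mulr_natl (F 0%N)); field; rewrite gt_eqF.
Qed.

End UniformIndex.

(** * The sparse update schedule *)

Section Schedule.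
Context {R : realType}.
Variable alpha : R.

Fixpoint last_update (i : nat) : nat :=
  if i is k.+1 then
    if alpha * i%:R < (i - last_update k)%:R then i else last_update k
  else 0.

Lemma last_update_le i : (last_update i <= i)%N.
Proof. by elim: i => //= i IHi; case: ifP => // _; exact: leqW. Qed.

Definition is_update i := last_update i == i.

Lemma is_updateS i :
  is_update i.+1 = (alpha * i.+1%:R < (i.+1 - last_update i)%:R).
Proof.
rewrite /is_update /=; case: ifP => _; first by rewrite eqxx.
by rewrite ltn_eqF// ltnS last_update_le.
Qed.

Lemma last_updateS i :
  last_update i.+1 = if is_update i.+1 then i.+1 else last_update i.
Proof. by rewrite is_updateS. Qed.

Hypotheses (alpha_gt0 : 0 < alpha) (alpha_lt1 : alpha < 1).

Lemma last_update_gap i : (i - last_update i)%:R <= alpha * i%:R.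
Proof.
elim: i => [|i _]; first by rewrite mulr0.
rewrite last_updateS is_updateS; case: ltP => // _.
by rewrite subnn mulr_ge0// ltW.
Qed.

Lemma last_update_gt0 i : (0 < i)%N -> (0 < last_update i)%N.
Proof.
move=> i0; rewrite lt0n; apply/eqP => l0; have := last_update_gap i.
by rewrite l0 subn0 leNgt gtr_pMl ?alpha_lt1// ltr0n.
Qed.

(* An update multiplies [last_update] by more than [1 / (1 - alpha)], so it
   raises its logarithm by at least [alpha]. *)
Lemma count_updates m : (0 < m)%N ->
  alpha * (\sum_(1 <= i < m.+1) is_update i)%:R
  <= alpha + ln (last_update m)%:R.
Proof.
elim: m => // m IHm _; have [->|m0] := posnP m.
  (* Stage 1 is an update with logarithm 0; the summand [alpha] pays for it. *)
  rewrite big_nat1 (_ : last_update 1 = 1)%N ?ln1 ?addr0.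
    by rewrite ler_piMr ?(ltW alpha_gt0)// lern1 leq_b1.
  by rewrite /= subn0 mulr1 alpha_lt1.
rewrite big_nat_recr//= natrD mulrDr -/(last_update m.+1) last_updateS.
have := IHm m0; case: ifPn => [|_]; last by rewrite mulr0 addr0.
rewrite mulr1 is_updateS => up IH.
set l := last_update m in IH up *.
have lm : (l <= m.+1)%N by rewrite leqW// last_update_le.
have l0 : 0 < l%:R :> R by rewrite ltr0n last_update_gt0.
have m1 : 0 < m.+1%:R :> R by rewrite ltr0n.
have : ln l%:R <= ln ((1 - alpha) * m.+1%:R).
  rewrite ler_ln ?posrE// ?mulr_gt0 ?subr_gt0//.
  by move: up; rewrite natrB//; lra.
rewrite lnM ?posrE ?subr_gt0//.
have := @le_ln1Dx R (- alpha); rewrite ltrN2 => /(_ alpha_lt1).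
lra.
Qed.

(** The extra [alpha] is absorbed by [alpha <= 1/2 <= ln 2 <= ln n]. *)
Lemma count_updates_le_ln n : (2 <= n)%N -> alpha <= 2^-1 ->
  (\sum_(1 <= i < n.+1) is_update i)%:R <= 2 * ln n%:R / alpha.
Proof.
move=> n2 alpha_le; rewrite ler_pdivlMr// mulrC.
have n0 : (0 < n)%N by exact: ltnW.
apply: le_trans (count_updates n n0) _.
have lnl : ln (last_update n)%:R <= ln n%:R :> R.
  by rewrite ler_ln ?posrE ?ltr0n ?last_update_gt0// ler_nat last_update_le.
have ln2 : (2^-1 : R) <= ln 2.
  have := @le_ln1Dx R (- 2^-1).
  rewrite (_ : 1 - 2^-1 = 2^-1) ?lnV ?posrE//; last by field.
  rewrite ltrN2 => /(_ ltac:(lra)); lra.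
have : ln 2 <= ln n%:R :> R by rewrite ler_ln ?posrE ?ltr0n// ler_nat.
lra.
Qed.

End Schedule.

(** * The method, its runs and its oracle count *)

Section SgdSparse.
Context {R : realType} {d : nat} {D : set 'rV[R]_d}.
Variables (mu alpha : R) (T : nat) (proj : 'rV[R]_d -> D) (x0 : D).
Hypothesis cD : convex_set D.

(* Each stage reads its [T] indices off the base-[i] digits of one uniform
   integer below [i ^ T].  Distinct stages are correlated, which is harmless:
   an update restarts from [x0] and its guarantee is about its own stage only. *)
Definition sample (i : nat) (w : R) (r : nat) : nat :=
  digit i (uniform_index (i ^ T) w) r.

Definition last_point (h : seq (event D)) : D :=
  match last (Output x0) h with Round _ z => z | Output z => z end.

(** The points of the history are averages, so the iterate is recomputed from the last query and its
    answer; round 1 restarts at [x0]. *)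
Definition query_point (t : nat) (h : seq (event D)) : D :=
  if t is t'.+2 then
    if last (Output x0) h is Round (((x, _), g) :: _) _
    then sgd_next mu proj t'.+1 x g else x0
  else x0.

Definition sparse_query (w : R) (i t : nat) (h : seq (event D)) :
    {fset FO D} :=
  if i is 0 then fset0
  else [fset ((query_point t h, (sample i w t.-1).+1) : FO D)]%fset.

Lemma sparse_query_index w i t h q :
  q \in sparse_query w i t h -> (1 <= q.2 <= i)%N.
Proof.
case: i => [|i]; first by rewrite in_fset0.
rewrite in_fset1 => /eqP ->; apply/andP; split; first exact: ltn0Sn.
exact: ltn_pmod.
Qed.

(* The queries are made at the SGD iterates; the intermediate points are their
   weighted averages, so that the output is the latest point of the history. *)
Definition sparse_point (w : R) (i t : nat) (h : seq (event D))
    (a : seq (FO D * 'rV[R]_d)) : D :=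
  if a is ((x, _), _) :: _ then sgd_avg t (last_point h) x else x0.

Definition sgd_sparse : fo_method D (measurableTypeR R) :=
  @FOMethod R d D (measurableTypeR R) x0
    (fun _ i _ => if is_update alpha i then T else 0%N)
    sparse_query sparse_query_index sparse_point (fun _ _ h => last_point h).

Variables (df : nat -> D -> 'rV[R]_d) (w : measurableTypeR R).

(** Round 1 has weight [2 / 2 = 1]: it discards the output of the previous stage, so the averages
    agree with those of [sgd] started at [x0]. *)
Lemma sgd_avg1 (z x : D) : sgd_avg 1 z x = x.
Proof.
apply/val_inj; rewrite -[sgd_avg 1 z x]/(mean (2 / 2) z x) divff//.
rewrite val_mean//; last by rewrite ler01 lexx.
by rewrite subrr scale0r add0r scale1r.
Qed.

Lemma answers1 (q : FO D) :
  answers df [fset q]%fset = [:: (q, df q.2 q.1)].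
Proof.
rewrite /answers; suff -> : enum_fset [fset q]%fset = [:: q] by [].
apply: perm_small_eq => //; apply: uniq_perm => // y.
by rewrite -[LHS]/(y \in [fset q]%fset) in_fset1 mem_seq1.
Qed.

Lemma after_roundsS i (h : seq (event D)) t :
  let h' := after_rounds sgd_sparse df w i.+1 h t in
  let x := query_point t.+1 h' in
  after_rounds sgd_sparse df w i.+1 h t.+1 =
  rcons h' (Round [:: (((x, (sample i.+1 w t).+1) : FO D), df (sample i.+1 w t).+1 x)]
    (sgd_avg t.+1 (last_point h') x)).
Proof.
move=> h' x.
have E : answers df (sparse_query w i.+1 t.+1 h')
    = [:: (((x, (sample i.+1 w t).+1) : FO D), df (sample i.+1 w t).+1 x)].
  exact: answers1.
transitivity (rcons h' (Round (answers df (sparse_query w i.+1 t.+1 h'))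
  (sparse_point w i.+1 t.+1 h' (answers df (sparse_query w i.+1 t.+1 h'))))).
  by [].
by rewrite E.
Qed.

(** The last event carries the whole SGD state: a query with its gradient, which determines the next
    iterate, and the current average. The restart removes any dependence on [h]. *)
Lemma last_after_rounds i (h : seq (event D)) t :
  let s := sample i.+1 w in
  let x := (sgd mu proj x0 df s t).1 in
  last (Output x0) (after_rounds sgd_sparse df w i.+1 h t.+1) =
  Round [:: (((x, (s t).+1) : FO D), df (s t).+1 x)]
    (sgd mu proj x0 df s t.+1).2.
Proof.
move=> s; elim: t => [|t IHt] x; rewrite after_roundsS last_rcons.
  by rewrite /= !sgd_avg1.
rewrite /last_point /query_point IHt /x /=.
by case: (sgd _ _ _ _ _ t).
Qed.

Definition stage_output (i : nat) : D :=
  if i is 0 then x0 else (sgd mu proj x0 df (sample i w) T).2.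

Lemma last_point_after_stage i :
  last_point (after_stage sgd_sparse df w i) = stage_output (last_update alpha i).
Proof.
elim: i => // i IHi; rewrite last_updateS.
transitivity (last_point (after_rounds sgd_sparse df w i.+1
  (after_stage sgd_sparse df w i) (if is_update alpha i.+1 then T else 0%N))).
  by rewrite /last_point /= last_rcons.
(* A stage without update repeats the previous output; with [T = 0] even an update runs no round and
   the output stays [x0]. *)
case: ifP => // _; have [T0|T_gt0] := posnP T.
  rewrite T0 [LHS]IHi /stage_output T0.
  by case: (last_update alpha i).
rewrite /stage_output -(prednK T_gt0) {1}/last_point.
by rewrite last_after_rounds.
Qed.

Lemma run_output_sgd_sparse i :
  run_output sgd_sparse df w i.+1 = stage_output (last_update alpha i.+1).
Proof.
by rewrite -last_point_after_stage /run_output /= /last_point last_rcons.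
Qed.

Lemma fo_complexity_sgd_sparse n :
  fo_complexity sgd_sparse df w n
  = (T * \sum_(1 <= i < n.+1) is_update alpha i)%N.
Proof.
rewrite /fo_complexity big_distrr/= 2!big_nat; apply: eq_bigr => -[|i] // _.
under eq_bigr do rewrite cardfs1.
rewrite sum_nat_const_nat muln1 subn1 /run_rounds /=.
by case: ifP; rewrite ?muln1 ?muln0.
Qed.

End SgdSparse.

(** * Accuracy of an old output on a longer prefix *)

Section PrefixMean.
Context {R : realType} {d : nat} {D : set 'rV[R]_d}.
Variables (f : nat -> D -> R) (df : nat -> D -> 'rV[R]_d) (G : R) (i p : nat).

(** The sum is split at [p]; each of the [i - p] new terms costs at most [G * diam D] by the
    Lipschitz bound. *)
Lemma prefix_mean_extend (z u : D) : compact D -> 0 <= G -> (0 < p <= i)%N ->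
  (forall j, (1 <= j <= i)%N -> G_lipschitz G (f j) (df j)) ->
  prefix_mean f i z - prefix_mean f i u
  <= p%:R / i%:R * (prefix_mean f p z - prefix_mean f p u)
     + (i - p)%:R / i%:R * (G * diam D).
Proof.
move=> kD G0 /andP[p0 pi] lipf.
have i0 : 0 < i%:R :> R by rewrite ltr0n (leq_trans p0).
have pn0 : p%:R != 0 :> R by rewrite pnatr_eq0 -lt0n.
have fle j : (1 <= j <= i)%N -> f j z - f j u <= G * diam D.
  move=> /lipf[lip _]; apply: le_trans (le_trans (ler_norm _) (lip z u)) _.
  by rewrite ler_wpM2l// enorm_le_diam//; exact: valP.
have E n : prefix_mean f n z - prefix_mean f n u
    = n%:R^-1 * \sum_(1 <= j < n.+1) (f j z - f j u).
  by rewrite /prefix_mean -mulrBr sumrB.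
rewrite !E [_ * (p%:R^-1 * _)]mulrA [p%:R / _]mulrC mulfK//.
rewrite (big_cat_nat _ (n := p.+1))//= mulrDr lerD2l.
rewrite mulrAC [leRHS]mulrC ler_wpM2l ?invr_ge0 ?(ltW i0)//.
apply: le_trans (_ : _ <= \sum_(p.+1 <= j < i.+1) (G * diam D)) _.
  apply: ler_sum_nat => j /andP[pj ji]; apply: fle.
  by rewrite (leq_trans _ pj).
by rewrite sumr_const_nat subSS mulr_natl.
Qed.

End PrefixMean.

(** * Expected accuracy at any stage *)

Section Accuracy.
Context {R : realType} {d : nat} {D : set 'rV[R]_d}.
Variables (mu G : R) (proj : 'rV[R]_d -> D) (x0 : D).
Hypotheses (mu_gt0 : 0 < mu) (G_ge0 : 0 <= G) (cD : convex_set D) (kD : compact D).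
Hypothesis projP : forall z (u : D),
  dotv (\val (proj z) - \val u) (\val (proj z) - \val u)
    <= dotv (z - \val u) (z - \val u).
Variables (f : nat -> D -> R) (df : nat -> D -> 'rV[R]_d) (i : nat).
Hypothesis scf : forall j, (1 <= j <= i)%N -> strongly_convex mu (f j) (df j).
Hypothesis lipf : forall j, (1 <= j <= i)%N -> G_lipschitz G (f j) (df j).

(** The left side is the expectation over the draws of stage [p]. The SGD error on prefix [p] enters
    with factor [p / i <= 1], and the new functions add the [alpha] term. *)
Lemma mean_sgd_prefix_le p T u alpha : (0 < p <= i)%N -> (0 < T)%N ->
  (i - p)%:R <= alpha * i%:R ->
  (p ^ T)%:R^-1 * \sum_(k < p ^ T)
      prefix_mean f i (sgd mu proj x0 df (digit p k) T).2
  <= prefix_mean f i u + 2 * G ^+ 2 / (mu * T.+1%:R) + alpha * (G * diam D).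
Proof.
move=> pi T0 gap; have /andP[p0 le_pi] := pi.
have i0 : 0 < i%:R :> R by rewrite ltr0n (leq_trans p0).
have diam0 : 0 <= diam D.
  by apply: le_trans (enorm_ge0 _) (enorm_le_diam kD _ _ (valP x0) (valP x0)).
have N0 : 0 < (p ^ T)%:R :> R by rewrite ltr0n expn_gt0 p0.
have sub j : (1 <= j <= p)%N -> (1 <= j <= i)%N.
  by move=> /andP[-> /leq_trans]; exact.
set B := 2 * G ^+ 2 / (mu * T.+1%:R).
have B0 : 0 <= B by rewrite divr_ge0 ?mulr_ge0 ?sqr_ge0// ltW.
have S := sum_sgd_le mu G proj x0 mu_gt0 cD projP f df p
  (fun j jp => scf j (sub j jp)) (fun j jp => lipf j (sub j jp)) u p0 T T0.
rewrite -/B in S.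
rewrite mulrC ler_pdivrMr//.
apply: le_trans (_ : _ <= \sum_(k < p ^ T) (prefix_mean f i u + alpha * (G * diam D)
  + p%:R / i%:R * (prefix_mean f p (sgd mu proj x0 df (digit p k) T).2
                   - prefix_mean f p u))) _.
  apply: ler_sum => k _.
  have := prefix_mean_extend f df G i p (sgd mu proj x0 df (digit p k) T).2 u
    kD G_ge0 pi lipf.
  have : (i - p)%:R / i%:R * (G * diam D) <= alpha * (G * diam D).
    by rewrite ler_wpM2r ?mulr_ge0// ler_pdivrMr.
  lra.
rewrite big_split/= sumr_const card_ord -mulr_sumr -[X in X + _]mulr_natr.
have : p%:R / i%:R * (\sum_(k < p ^ T)
    (prefix_mean f p (sgd mu proj x0 df (digit p k) T).2 - prefix_mean f p u))
    <= (p ^ T)%:R * B.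
  have pi0 : 0 <= p%:R / i%:R :> R by rewrite divr_ge0// ltW.
  apply: le_trans (ler_wpM2l pi0 S) _.
  apply: ler_piMl; first by rewrite mulr_ge0 ?(ltW N0).
  by rewrite ler_pdivrMr// mul1r ler_nat.
lra.
Qed.

End Accuracy.

(** * Choice of the parameters and conclusion *)

Theorem theorem2 (R : realType) :
  exists C : R, 0 < C /\
  forall mu L G Delta : R, 0 < mu ->
  exists eps0 : R, 0 < eps0 /\
  forall (d : nat) (D : set 'rV[R]_d),
    D !=set0 -> convex_set D -> compact D -> diam D = Delta ->
  forall eps : R, 0 < eps -> eps <= eps0 ->
  exists (disp : measure_display) (Omega : measurableType disp)
         (P : probability Omega R) (M : fo_method D Omega),
  forall (n : nat) (f : nat -> D -> R) (df : nat -> D -> 'rV[R]_d),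
    (2 <= n)%N ->
    (forall j : nat, (1 <= j <= n)%N -> admissible mu L G (f j) (df j)) ->
    (forall i : nat, (1 <= i <= n)%N ->
       P.-integrable [set: Omega]
         (fun w => (prefix_mean f i (run_output M df w i))%:E) /\
       forall xs : D, is_argmin (prefix_mean f i) xs ->
         ('E_P[fun w => prefix_mean f i (run_output M df w i)]
            - (prefix_mean f i xs)%:E <= eps%:E)%E) /\
    (forall w : Omega,
       (fo_complexity M df w n)%:R <=
         C * (G ^+ 3 * Delta * ln n%:R / (mu * eps ^+ 2))).
Proof.
(* 32 = 8 * 4: at most [8 * G ^+ 2 / (mu * eps)] rounds per update and [2 * ln n / alpha = 4 * G *
   Delta * ln n / eps] updates. *)
exists 32; split=> // mu L G Delta mu_gt0.
(* Otherwise [D] will turn out to be a single point once admissible functions exist, and [T = 0]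
   suffices. *)
pose nondeg := (0 < G) && (0 < Delta).
(* The first bound gives [4 * G ^+ 2 / (mu * eps) >= 1], so rounding [T] up at most doubles it; the
   second gives [alpha <= 1/2]. *)
pose eps0 := if nondeg then Num.min (4 * G ^+ 2 / mu) (G * Delta) else 1.
exists eps0; split.
  rewrite /eps0; case: ifP => // /andP[G0 D0].
  by rewrite lt_min ?divr_gt0 ?mulr_gt0 ?exprn_gt0.
move=> d D D0 cD kD diamD eps eps_gt0 eps_le.
have [proj projP] := choice (ex_proj D D0 cD kD).
have [a Da] := D0; pose x0 : D := SigSub (mem_set Da).
(* Chosen so that the SGD error [2 * G ^+ 2 / (mu * (T + 1))] is at most [eps / 2]. *)
pose T := if nondeg then (Num.truncn (4 * G ^+ 2 / (mu * eps))).+1 else 0%N.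
pose alpha := if nondeg then eps / (2 * (G * Delta)) else 2^-1.
have alphaP : 0 < alpha /\ alpha <= 2^-1.
  rewrite /alpha; move: eps_le; rewrite /eps0; case: ifP => // /andP[G0 De0].
  rewrite le_min => /andP[_ le2]; have GD : 0 < G * Delta by rewrite mulr_gt0.
  rewrite divr_gt0 ?mulr_gt0// ler_pdivrMr ?mulr_gt0//; split=> //; lra.
have [alpha_gt0 alpha_half] := alphaP.
have alpha_lt1 : alpha < 1 by lra.
exists _, (measurableTypeR R), (uniform_prob (@ltr01 R)),
  (sgd_sparse mu alpha T proj x0).
move=> n f df n2 adm.
have scf j : (1 <= j <= n)%N -> strongly_convex mu (f j) (df j) by move=> /adm[].
have lipf j : (1 <= j <= n)%N -> G_lipschitz G (f j) (df j) by move=> /adm[].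
have [_ G_bound] := lipf 1%N (ltnW n2).
have G_ge0 : 0 <= G := le_trans (enorm_ge0 _) (G_bound x0).
have diam_ge (x y : D) : enorm (\val x - \val y) <= Delta.
  by rewrite -diamD enorm_le_diam//; exact: valP.
have Delta_ge0 : 0 <= Delta := le_trans (enorm_ge0 _) (diam_ge x0 x0).
(* Clear if [Delta <= 0]. If [G = 0], the first function is constant with zero gradient, and strong
   convexity forces [x = y]. *)
have degenerate : ~~ nondeg -> forall x y : D, x = y.
  move=> nd x y; apply/val_inj/eqP; rewrite -subr_eq0; apply/eqP/dotvv_le0.
  rewrite -sqr_enorm; have e0 := enorm_ge0 (\val x - \val y).
  have [De0|De0] := leP Delta 0.
    have -> : enorm (\val x - \val y) = 0; last by rewrite expr0n.
    by apply/le_anti; rewrite e0 (le_trans (diam_ge x y)).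
  have G0 : G = 0.
    by apply/le_anti; move: nd; rewrite /nondeg De0 G_ge0 leNgt !andbT.
  have [+ dfle] := lipf 1%N (ltnW n2) => /(_ x y).
  rewrite G0 mul0r normr_le0 subr_eq0 => /eqP fxy.
  have df0 : df 1%N y = 0.
    apply: dotvv_le0; rewrite -sqr_enorm.
    have := dfle y; rewrite G0 => le0.
    have -> : enorm (df 1%N y) = 0; last by rewrite expr0n.
    by apply/le_anti; rewrite le0 enorm_ge0.
  have := scf 1%N (ltnW n2) x y.
  rewrite fxy df0 -(scale0r (0 : 'rV_d)) dotvZl mul0r addr0.
  by rewrite gerDl pmulr_rle0// divr_gt0.
split=> [[//|i] /andP[_ le_in]|w]; last first.
  rewrite fo_complexity_sgd_sparse natrM.
  have [nd|/negbTE nd] := boolP nondeg; last first.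
    rewrite /T nd mul0r !mulr_ge0 ?invr_ge0 ?mulr_ge0 ?exprn_ge0 ?ln_ge0//
      ?ler1n ?(ltW mu_gt0) ?(ltW eps_gt0)//.
    exact: ltnW.
  have /andP[G0 De0] := nd.
  have cnt := count_updates_le_ln alpha alpha_gt0 alpha_lt1 n n2 alpha_half.
  have Tle : T%:R <= 8 * G ^+ 2 / (mu * eps).
    rewrite /T nd -natr1.
    have q0 : 0 <= 4 * G ^+ 2 / (mu * eps).
      by rewrite divr_ge0 ?mulr_ge0 ?exprn_ge0// ltW.
    have t_le : (Num.truncn (4 * G ^+ 2 / (mu * eps)))%:R <= 4 * G ^+ 2 / (mu * eps).
      by rewrite truncn_le.
    have : 1 <= 4 * G ^+ 2 / (mu * eps).
      rewrite ler_pdivlMr ?mulr_gt0// mul1r mulrC -ler_pdivlMr//.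
      by move: eps_le; rewrite /eps0 nd le_min => /andP[].
    have -> : 8 * G ^+ 2 / (mu * eps) = 2 * (4 * G ^+ 2 / (mu * eps)).
      by field; rewrite !gt_eqF.
    lra.
  apply: le_trans (ler_pM _ _ Tle cnt) _; rewrite ?ler0n//.
  rewrite le_eqVlt; apply/predU1P; left; rewrite /alpha nd; field.
  by rewrite !gt_eqF.
set p := last_update alpha i.+1.
have p_gt0 : (0 < p)%N by exact: last_update_gt0.
have p_le : (p <= i.+1)%N by exact: last_update_le.
pose F k := prefix_mean f i.+1 (sgd mu proj x0 df (digit p k) T).2.
(* The output depends on [w] only through the uniform integer drawn at the last update [p]. *)
have FE : (fun w => prefix_mean f i.+1
      (run_output (sgd_sparse mu alpha T proj x0) df w i.+1))
    = (fun w => F (uniform_index (p ^ T) w)).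
  apply/funext => w; rewrite run_output_sgd_sparse// -/p /F /stage_output.
  by case: (p) p_gt0.
have N_gt0 : (0 < p ^ T)%N by rewrite expn_gt0 p_gt0.
have [iF EF] := uniform_indexP F (p ^ T) N_gt0.
have FE' : (fun w => (prefix_mean f i.+1
      (run_output (sgd_sparse mu alpha T proj x0) df w i.+1))%:E)
    = (fun w => (F (uniform_index (p ^ T) w))%:E).
  by apply/funext => w; rewrite -[in RHS](congr1 (@^~ w) FE).
rewrite FE' FE; split=> // xs _; rewrite EF -EFinB lee_fin /F.
have [nd|nd] := boolP nondeg; last first.
  rewrite (eq_bigr (fun=> prefix_mean f i.+1 xs)) => [|k _]; last first.
    by congr (prefix_mean _ _); exact: degenerate.
  rewrite sumr_const card_ord -(mulr_natl (prefix_mean f i.+1 xs)) mulKf ?subrr ?ltW//.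
  by rewrite pnatr_eq0 -lt0n.
have /andP[G0 De0] := nd.
have sub j : (1 <= j <= i.+1)%N -> (1 <= j <= n)%N.
  by move=> /andP[-> /leq_trans]; exact.
have T_gt0 : (0 < T)%N by rewrite /T nd.
have pi : (0 < p <= i.+1)%N by rewrite p_gt0.
have := mean_sgd_prefix_le mu G proj x0 mu_gt0 G_ge0 cD kD projP f df i.+1
  (fun j ji => scf j (sub j ji)) (fun j ji => lipf j (sub j ji))
  p T xs alpha pi T_gt0 (last_update_gap alpha alpha_gt0 i.+1).
rewrite diamD.
have -> : alpha * (G * Delta) = eps / 2.
  by rewrite /alpha nd; field; rewrite !gt_eqF.
have : 2 * G ^+ 2 / (mu * T.+1%:R) <= eps / 2.
  rewrite ler_pdivrMr ?mulr_gt0//.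
  have : 4 * G ^+ 2 / (mu * eps) < T.+1%:R.
    by rewrite /T nd (lt_trans (truncnS_gt _))// ltr_nat.
  rewrite ltr_pdivrMr ?mulr_gt0//; lra.
move=> B_le /le_trans; rewrite lerBlDr; apply.
by rewrite -addrA addrC lerD2r [leRHS]splitr lerD2r.
Qed.
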